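(* Let $m\geq 1$, let $\Gamma=C_{4m}=\langle\gamma\rangle$ be the cyclic group of order $4m$, and let $\sigma=\gamma^{2m}$. Then there is no centrally symmetric convex $3$-polytope $P$ in $\mathbb{E}^3$ such that $\Gamma(P)=\Gamma$ and $\sigma$ is realized as the central symmetry of $P$ (i.e., there is no isomorphism $\Gamma\to\Gamma(P)$ sending $\sigma$ to the automorphism induced by $x\mapsto -x$).
   Context: For a convex polytope $P$, $\Gamma(P)$ is the group of combinatorial automorphisms of its face lattice. $P$ is centrally symmetric if $-P=P$ (with respect to the origin), so $x\mapsto -x$ induces an automorphism of $P$. *)

(* Defs.v *)
From HB Require Import structures.
From mathcomp Require Import all_boot all_order all_algebra.
From mathcomp Require Import boolp classical_sets reals.
Set Implicit Arguments. Unset Strict Implicit. Unset Printing Implicit Defensive.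
Import Order.TTheory GRing.Theory Num.Theory.
Local Open Scope ring_scope.
Local Open Scope classical_set_scope.

Section Polytopes.
Variable R : realType.
Notation pt := 'rV[R]_3.

Definition dotp (a x : pt) : R := \sum_(i < 3) a 0 i * x 0 i.

Definition conv (S : seq pt) : set pt :=
  [set x | exists l : 'I_(size S) -> R,
     (forall i, 0 <= l i) /\ \sum_i l i = 1 /\
     x = \sum_i l i *: S`_(nat_of_ord i)].

Definition full_dim3 (P : set pt) : Prop :=
  ~ exists (a : pt) (b : R), a != 0 /\ forall x, P x -> dotp a x = b.

Definition is_3polytope (P : set pt) : Prop :=
  exists S : seq pt, P = conv S /\ full_dim3 P.

Definition centrally_symmetric (P : set pt) : Prop :=
  [set - x | x in P] = P.

(* faces: intersections of P with supporting hyperplanes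
   (a = 0 gives the improper faces P and the empty set) *)
Definition is_face (P F : set pt) : Prop :=
  exists (a : pt) (b : R), (forall x, P x -> dotp a x <= b) /\
    F = [set x | P x /\ dotp a x = b].

Definition eq_on_faces (P : set pt) (f g : set pt -> set pt) : Prop :=
  forall F, is_face P F -> f F = g F.

Definition face_aut (P : set pt) (phi : set pt -> set pt) : Prop :=
  (forall F, is_face P F -> is_face P (phi F)) /\
  (exists psi : set pt -> set pt,
     (forall F, is_face P F -> is_face P (psi F)) /\
     (forall F, is_face P F -> psi (phi F) = F /\ phi (psi F) = F)) /\
  (forall F G, is_face P F -> is_face P G -> (F `<=` G <-> phi F `<=` phi G)).

Definition central_map (F : set pt) : set pt := [set - x | x in F].

(* Gamma(P) is cyclic of order n, with a generator g (the image of gamma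
   under an isomorphism C_n -> Gamma(P)); automorphisms are identified when
   they agree on faces. *)
Definition aut_cyclic_gen (P : set pt) (n : nat) (g : set pt -> set pt) : Prop :=
  face_aut P g /\
  (forall h, face_aut P h -> exists k : nat, eq_on_faces P h (iter k g)) /\
  eq_on_faces P (iter n g) id /\
  (forall j : nat, (0 < j < n)%N -> ~ eq_on_faces P (iter j g) id).

End Polytopes.

(* Main.v *)
(** If gamma^(2m) is the central symmetry, then h = gamma^m satisfies h^2 = -1 on
    the face lattice. No proper nonempty face F equals -F, so h acts on the proper
    nonempty faces with all orbits of size 4, and their number N is divisible by 4.
    On the other hand N = 2 mod 4 (a mod 4 shadow of Euler's formula). The faces
    correspond to the cells of the normal fan in R^d \ 0, two functionals lying in
    the same cell when they are maximal at the same vertices. The cells meeting an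
    affine flat are odd in number, by a sweep in the style of Hadwiger's
    construction of the Euler characteristic. Let N_k count the cells meeting a
    k-dimensional coordinate subspace outside 0, and K_k those meeting a parallel
    affine copy of it off the origin. Comparing the two sides of a hyperplane
    through 0, central symmetry gives N_(k+1) + N_k = 2 K_k = 2 mod 4, so that
    N_d = 2 d mod 4. *)

Require Import Defs.
From mathcomp Require Import all_boot all_order all_algebra.
From mathcomp Require Import boolp classical_sets reals.
From mathcomp Require Import lra zify ring.
Set Implicit Arguments. Unset Strict Implicit. Unset Printing Implicit Defensive.
Import Order.TTheory GRing.Theory Num.Theory.
Local Open Scope ring_scope.

(** * Divisibility of cardinalities by counting orbits *)

Lemma dvdn_card_fibers (T : finType) (rT : eqType) (e : T -> rT) (A : {set T}) k :
  {in A, forall x, k %| #|[set y in A | e y == e x]|}%N -> (k %| #|A|)%N.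
Proof.
move=> dvdk; rewrite (card_partition (preim_partitionP e A)).
apply: dvdn_sum => B /imsetP[x Ax ->].
have -> // : [set y in A | e x == e y] = [set y in A | e y == e x].
  by apply/setP => y; rewrite !inE eq_sym.
exact: dvdk.
Qed.

Lemma dvd2_card_free (T : finType) (f : T -> T) (A : {set T}) :
    {in A, forall x, f x \in A} -> {in A, forall x, f (f x) = x} ->
    {in A, forall x, f x != x} -> (2 %| #|A|)%N.
Proof.
move=> fA ffA fN; apply: (@dvdn_card_fibers _ _ (fun x => [set x; f x])) => x Ax.
have -> : [set y in A | [set y; f y] == [set x; f x]] = [set x; f x].
  apply/setP => y; rewrite inE; apply/andP/idP => [[_ /eqP <-]|].
    by rewrite !inE eqxx.
  by case/set2P=> ->; rewrite ?fA ?ffA // finset.setUC.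
by rewrite cards2 eq_sym fN.
Qed.

(** The fibres of [c], which sends a point to its orbit, are the orbits. A fixed point of [f] or of
    its third iterate would be fixed by [f \o f], so every orbit has four elements. *)
Lemma dvd4_card_free (T : finType) (f : T -> T) (A : {set T}) :
    {in A, forall x, f x \in A} -> {in A, forall x, f (f (f (f x))) = x} ->
    {in A, forall x, f (f x) != x} -> (4 %| #|A|)%N.
Proof.
move=> fA f4A fN; pose c x := [set y in [:: x; f x; f (f x); f (f (f x))]].
apply: (@dvdn_card_fibers _ _ c) => x Ax.
have cf y : y \in A -> c (f y) = c y.
  move=> Ay; apply/setP => z; rewrite !inE f4A //.
  by do 4!case: (z == _).
have -> : [set y in A | c y == c x] = c x.
  apply/setP => y; rewrite inE; apply/andP/idP => [[_ /eqP <-]|].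
    by rewrite !inE eqxx.
  by rewrite inE !inE => /or4P[] /eqP->; rewrite ?cf ?fA ?eqxx.
have fx y : y \in A -> f y != y.
  by move=> Ay; apply/eqP => E; move: (fN y Ay); rewrite !E eqxx.
rewrite /c cardsE; suff /card_uniqP -> : uniq [:: x; f x; f (f x); f (f (f x))] by [].
have fC y : y \in A -> y != f y by move=> Ay; rewrite eq_sym fx.
have fC2 y : y \in A -> y != f (f y) by move=> Ay; rewrite eq_sym fN.
rewrite /= !inE !negb_or !fC ?fC2 ?fA //= !andbT.
by apply/eqP => E; move: (fx x Ax); rewrite {1}E f4A // eqxx.
Qed.

Lemma odd_card_addb (T : finType) (a b : pred T) :
  odd #|[set x | a x (+) b x]| = odd #|[set x | a x]| (+) odd #|[set x | b x]|.
Proof.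
have oddE c : odd #|[set x : T | c x]| = \big[addb/false]_x c x.
  rewrite -sum1_card (big_morph odd oddD (erefl _)) big_mkcond /=.
  by apply: eq_bigr => x _; rewrite inE; case: (c x).
by rewrite !oddE big_split.
Qed.

(** * Parity of a family of relatively open intervals *)

Section Sweep.
Variables (R : realType) (J : finType).

(** Merges finitely many conditions, each valid far enough to the left in [A]. [A] will be a
    half-line [t < s] (points just after t), all of [R] (points far to the left) or the positive
    step lengths. *)
Lemma finite_eventually_left (A : R -> Prop) (Q : J -> R -> Prop) :
    (exists s, A s) -> (forall s t, A s -> A t -> A (Num.min s t)) ->
    (forall j, exists2 s, A s & forall y, A y -> y <= s -> Q j y) ->
  exists2 s, A s & forall j, Q j s.
Proof.
move=> [s0 As0] minA evQ.
suff [s As sQ] : exists2 s, A s &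
    forall j, j \in enum J -> forall y, A y -> y <= s -> Q j y.
  by exists s => // j; apply: (sQ j) => //; rewrite mem_enum.
elim: (enum J) => [|j js [s As sQ]]; first by exists s0.
have [t At tQ] := evQ j; exists (Num.min s t); first exact: minA.
move=> i; rewrite inE => /orP[/eqP ->|ijs] y Ay; rewrite le_min => /andP[ys yt].
  exact: tQ.
exact: sQ.
Qed.

Variable I : J -> R -> Prop.
(** Together with [I_extl] and [I_extr]: each [I j] is empty, a single point or an open interval. *)
Hypothesis I_convex : forall j s t u, I j s -> I j u -> s <= t <= u -> I j t.
Hypothesis I_extl : forall j s t, I j s -> I j t -> s < t -> exists2 u, u < s & I j u.
Hypothesis I_extr : forall j s t, I j s -> I j t -> s < t -> exists2 u, t < u & I j u.
Hypothesis I_odd : forall t, odd #|[set j | `[< I j t >]]|.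

(* [left_end j = None] stands for the left end -oo, and [germ j t] says that [I j]
   contains a right neighbourhood of t with t removed. *)
Let bounded j := `[< exists b, forall t, I j t -> b <= t >].
Let left_end j := if bounded j then Some (inf (I j)) else None.
Let germ j t := exists2 s, t < s & forall y, t < y <= s -> I j y.

Let below_of_None j b : left_end j = None -> exists2 t, t < b & I j t.
Proof.
rewrite /left_end /bounded; case: asboolP => // nlb _.
apply: contrapT => nt; apply: nlb; exists b => t It; rewrite leNgt.
by apply/negP => tb; apply: nt; exists t.
Qed.

Let left_end_Some j t : (exists s, I j s) -> left_end j = Some t ->
  (forall s, I j s -> t <= s) /\ (forall u, t < u -> exists2 s, s < u & I j s).
Proof.
rewrite /left_end /bounded => nI; case: asboolP => // -[b bI] [<-].
have hI : has_inf (I j) by split => //; exists b => s /bI.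
split=> [s Is|u tu]; first by apply: ge_inf => //; case: hI.
by have [s Is su] := inf_adherent (eps := u - inf (I j)) (ltac:(lra)) hI;
   exists s => //; lra.
Qed.

(** A single point contains its left end but has no germ there; an open interval has the germ but
    not the end. At any other t the two bits agree. *)
Let left_endP j t : (exists s, I j s) ->
  (left_end j == Some t) = `[< I j t >] (+) `[< germ j t >].
Proof.
move=> nI; case: eqP => [/(left_end_Some nI)[lb glb]|nt].
  case: asboolP => [It|nIt] /=.
    apply/esym/negP => /asboolP[s ts Is].
    have [u ut Iu] : exists2 u, u < t & I j u.
      by apply: (I_extl It _ ts); apply: Is; rewrite ts lexx.
    by have := lb u Iu; lra.
  apply/esym/asboolP; have [s0 Is0] := nI; exists s0.
    by rewrite lt_neqAle lb // andbT; apply/eqP => E; apply: nIt; rewrite E.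
  move=> y /andP[ty ys]; have [s sy Is] := glb y ty.
  by apply: (I_convex Is Is0); rewrite (ltW sy) ys.
(* When t is not the left end, meeting t or t+ forces points of [I j] below t; convexity and
   [I_extr] then make the two bits equal. *)
have lower : I j t \/ germ j t -> exists2 u, u < t & I j u.
  move=> It; case E : (left_end j) => [t'|]; last exact: below_of_None.
  have [lb glb] := left_end_Some nI E.
  have t't : t' <= t.
    case: It => [/lb //|[s ts Is]]; rewrite leNgt; apply/negP => tt'.
    pose v := Num.min s t'; have tv : t < v by rewrite lt_min ts.
    have [vs vt] : v <= s /\ v <= t' by split; rewrite ge_min lexx ?orbT.
    have /lb := Is ((t + v) / 2) (ltac:(apply/andP; split; lra)); lra.
  by apply: glb; rewrite lt_neqAle t't andbT; apply/eqP => E'; apply: nt; rewrite E E'.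
suff -> : `[< germ j t >] = `[< I j t >] by rewrite addbb.
apply/asboolP/asboolP => [gt|It].
  have [u ut Iu] := lower (or_intror gt); have [s ts Is] := gt.
  by apply: (I_convex Iu (Is s _)); rewrite ?ts ?lexx ?(ltW ut) ?(ltW ts).
have [u ut Iu] := lower (or_introl It); have [s ts Is] := I_extr Iu It ut.
by exists s => // y /andP[ty ys]; apply: (I_convex It Is); rewrite (ltW ty) ys.
Qed.

(* The intervals with left end t are those containing exactly one of t and t+; as
   both t and t+ lie in an odd number of intervals, there are evenly many of them.
   Those with left end -oo are the ones containing a point far to the left. *)
Lemma odd_sweep : odd #|[set j | `[< exists t, I j t >]]|.
Proof.
set A := [set j | _]; have An j : j \in A -> exists t, I j t.
  by rewrite inE => /asboolP.
have even_fiber t : ~~ odd #|[set j in A | left_end j == Some t]|.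
  have [s ts sQ] : exists2 s, t < s & forall j, `[< germ j t >] = `[< I j s >].
    apply: finite_eventually_left => [|s u ts tu|j]; first by exists (t + 1); lra.
      by rewrite lt_min ts.
    have [[s ts Is]|ng] := pselect (germ j t).
      exists s => // y ty ys; apply/asboolP/asboolP => [_|_]; last by exists s.
      by apply: Is; rewrite ty.
    have -> : `[< germ j t >] = false by apply/asboolP.
    have [[y1 ty1 I1]|nI] := pselect (exists2 y, t < y & I j y); last first.
      exists (t + 1) => [|y ty _]; first by lra.
      by apply/esym/asboolP => Iy; apply: nI; exists y.
    (* Without a germ some [y2] before [y1] is missed, and by convexity nothing of [I j] lies
       between t and [y2]. *)
    have [y2 /andP[ty2 y21] nI2] : exists2 y, t < y <= y1 & ~ I j y.
      apply: contrapT => nE; apply: ng; exists y1 => // y ty.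
      by apply: contrapT => nIy; apply: nE; exists y.
    exists y2 => // y ty yy2; apply/esym/asboolP => Iy; apply: nI2.
    by apply: (I_convex Iy I1); rewrite yy2.
  suff -> : [set j in A | left_end j == Some t] =
      [set j | `[< I j t >] (+) `[< I j s >]].
    by rewrite odd_card_addb !I_odd.
  apply/setP => j; rewrite [LHS]inE [RHS]inE.
  have [Aj|nAj] /= := boolP (j \in A).
    by rewrite left_endP ?sQ //; apply: An.
  have nI u : `[< I j u >] = false.
    by apply/asboolP => Iu; move: nAj; rewrite inE => /asboolP; apply; exists u.
  by rewrite !nI.
have odd_None : odd #|[set j in A | left_end j == None]|.
  have [s _ sQ] : exists2 s : R, True & forall j,
      ((j \in A) && (left_end j == None)) = `[< I j s >].
    apply: finite_eventually_left => // [|j]; first by exists 0.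
    have [Aj|nAj] /= := boolP (j \in A); last first.
      exists 0 => // y _ _; apply/esym/asboolP => Iy; move: nAj.
      by rewrite inE => /asboolP; apply; exists y.
    have nI := An j Aj; case E : (left_end j) => [t|].
      exists (t - 1) => // y _ yt; apply/esym/asboolP => Iy.
      by have [/(_ y Iy)] := left_end_Some nI E; lra.
    have [s0 I0] := nI; exists s0 => // y _ ys.
    have [u uy Iu] := below_of_None y E; apply/esym/asboolP.
    by apply: (I_convex Iu I0); rewrite (ltW uy).
  suff -> : [set j in A | left_end j == None] = [set j | `[< I j s >]] by [].
  by apply/setP => j; rewrite [RHS]inE -sQ inE.
rewrite -(cardsID [set j | left_end j == None]) oddD.
have -> : A :&: [set j | left_end j == None] = [set j in A | left_end j == None].
  by apply/setP => j; rewrite !inE.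
rewrite odd_None addTb -dvdn2.
apply: (@dvdn_card_fibers _ _ left_end) => j; rewrite !inE => /andP[].
case E : (left_end j) => [t|] // _ Aj.
rewrite dvdn2; suff <- : [set j in A | left_end j == Some t] =
  [set y in A :\: [set j | left_end j == None] | left_end y == Some t] by [].
apply/setP => i; rewrite !inE; case: eqP => [->|_]; rewrite ?andbF ?andbT //.
Qed.
End Sweep.
(** * Cells of the normal fan *)

Section Cells.
Variables (R : realType) (d n : nat) (p : 'I_n -> 'rV[R]_d).

Definition dot (a x : 'rV[R]_d) : R := \sum_(i < d) a 0 i * x 0 i.

Lemma dotD a b x : dot (a + b) x = dot a x + dot b x.
Proof. by rewrite -big_split; apply: eq_bigr => i _; rewrite mxE mulrDl. Qed.

Lemma dotZ k a x : dot (k *: a) x = k * dot a x.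
Proof. by rewrite mulr_sumr; apply: eq_bigr => i _; rewrite mxE mulrA. Qed.

Lemma dotN a x : dot (- a) x = - dot a x.
Proof. by rewrite -scaleN1r dotZ mulN1r. Qed.

Lemma dotC a x : dot a x = dot x a.
Proof. by apply: eq_bigr => i _; rewrite mulrC. Qed.

Lemma dotxN a x : dot a (- x) = - dot a x.
Proof. by rewrite dotC dotN dotC. Qed.

Lemma dot0 x : dot 0 x = 0.
Proof. by rewrite -(scale0r 0) dotZ mul0r. Qed.

(* The vertex labels of the face in direction a; its fibres are the cells of the
   normal fan, so a cell is represented by the value of [top_set] on it. *)
Definition top_set (a : 'rV[R]_d) : {set 'I_n} :=
  [set i | [forall j, dot a (p j) <= dot a (p i)]].

Definition cells (D : 'rV[R]_d -> Prop) : {set {set 'I_n}} :=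
  [set T | `[< exists2 a, D a & top_set a = T >]].

Lemma top_setP a i : reflect (forall j, dot a (p j) <= dot a (p i)) (i \in top_set a).
Proof. by rewrite inE; apply: forallP. Qed.

Lemma cellsP (D : 'rV[R]_d -> Prop) T :
  reflect (exists2 a, D a & top_set a = T) (T \in cells D).
Proof. by rewrite inE; apply: asboolP. Qed.

Lemma top_set_ex a (i0 : 'I_n) : exists i, i \in top_set a.
Proof.
case: (@Order.TotalTheory.arg_maxP _ _ _ i0 xpredT (fun i => dot a (p i)) isT) => i _ imax.
by exists i; apply/top_setP => j; apply: imax.
Qed.

(** Cells are convex cones: a label top for the combination is compared with a label [k] top for
    both [a] and [b], and [0 < s] makes it top for [a]. Allowing [t = 0] covers scaling and the end
    of a segment. *)
Lemma top_set_comb a b s t : 0 < s -> 0 <= t -> top_set a = top_set b ->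
  top_set (s *: a + t *: b) = top_set a.
Proof.
move=> s0 t0 ab; apply/setP => i; apply/idP/idP => [/top_setP imax|ia].
  have [k ka] := top_set_ex a i; have kb := ka; rewrite ab in kb.
  have := imax k; rewrite !dotD !dotZ => le.
  move/top_setP: ka => ka; move/top_setP: kb => kb.
  apply/top_setP => j; apply: le_trans (ka j) _.
  by rewrite -(ler_pM2l s0); have := ler_wpM2l t0 (kb i); lra.
have ib := ia; rewrite ab in ib.
apply/top_setP => j; rewrite !dotD !dotZ; apply: lerD; apply: ler_wpM2l => //.
- exact: ltW.
- exact/top_setP.
- exact/top_setP.
Qed.

Lemma top_setZ s a : 0 < s -> top_set (s *: a) = top_set a.
Proof.
by move=> s0; rewrite -(@top_set_comb a a s 0 s0) // scale0r addr0.
Qed.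

(** Cells are relatively open: the common top labels stay tied along the line through [a] and [b],
    and the finitely many others stay strictly below for a short step past [b]. *)
Lemma top_set_extend a b : top_set a = top_set b ->
  exists2 e, 0 < e & top_set (b + e *: (b - a)) = top_set b.
Proof.
move=> ab.
case: (pickP 'I_n) => [k _|n0]; last first.
  by exists 1 => //; apply/setP => i; have := n0 i.
have [i0 i0b] := top_set_ex b k; have i0a := i0b; rewrite -ab in i0a.
have [e e0 eQ] : exists2 e, 0 < e & forall j, j \notin top_set b ->
    dot (b + e *: (b - a)) (p j) < dot (b + e *: (b - a)) (p i0).
  apply: (@finite_eventually_left _ _ (fun e => 0 < e) (fun j e => j \notin top_set b ->
    dot (b + e *: (b - a)) (p j) < dot (b + e *: (b - a)) (p i0))).
  - by exists 1.
  - by move=> s t s0 t0; rewrite lt_min s0.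
  move=> j; have [jb|jb] := boolP (j \in top_set b); first by exists 1.
  have lt : dot b (p j) < dot b (p i0).
    rewrite ltNge; apply: contra jb => le; apply/top_setP => l.
    by apply: le_trans le; move/top_setP: i0b.
  pose w := dot (b - a) (p i0) - dot (b - a) (p j).
  have w0 : 0 < `|w| + 1 by rewrite ltr_wpDl.
  (* Up to this step length the gap at [b] exceeds the possible loss [y * |w|]; the [+ 1] gives
     strictness and a positive denominator. *)
  exists ((dot b (p i0) - dot b (p j)) / (`|w| + 1)) => [|y y0].
    by rewrite divr_gt0 // subr_gt0.
  rewrite ler_pdivlMr // => le _; rewrite !(dotD b) !dotZ.
  have : - (y * w) <= y * `|w|.
    by rewrite -mulrN; apply: ler_wpM2l; [exact: ltW|rewrite -normrN ler_norm].
  rewrite /w in le *; lra.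
exists e => //; apply/setP => j; apply/idP/idP => [/top_setP jmax|jb].
  by apply: contraLR isT => /eQ; rewrite ltNge jmax.
have eqT l : l \in top_set b -> dot (b + e *: (b - a)) (p l) = dot (b + e *: (b - a)) (p i0).
  move=> lb; have la := lb; rewrite -ab in la.
  have eqd c : l \in top_set c -> i0 \in top_set c -> dot c (p l) = dot c (p i0).
    by move=> /top_setP lc /top_setP ic; apply/eqP; rewrite eq_le lc ic.
  by rewrite !dotD !dotZ !dotD !dotN !eqd.
apply/top_setP => l; rewrite (eqT j jb).
by have [/eqT->//|/eQ/ltW] := boolP (l \in top_set b).
Qed.

(* Only the first k coordinates are free: a flat of dimension [minn k d]. *)
Definition flat k (v a : 'rV[R]_d) := forall i : 'I_d, (k <= i)%N -> a 0 i = v 0 i.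

(** Induction on k, sweeping along the new coordinate: each cell occupies a relatively open interval
    of heights, and each slice is a flat with one free coordinate less, hence meets an odd number of
    cells. *)
Lemma odd_cells_flat k v : (k <= d)%N -> odd #|cells (flat k v)|.
Proof.
elim: k v => [|k IHk] v kd.
  suff -> : cells (flat 0 v) = [set top_set v] by rewrite cards1.
  apply/setP => T; rewrite finset.in_set1; apply/cellsP/eqP => [[a av <-]|->]; last by exists v.
  by congr top_set; apply/rowP => i; apply: av.
pose q := Ordinal kd.
pose I T t := exists2 a, flat k.+1 v a /\ a 0 q = t & top_set a = T.
have flat_comb a b s t : flat k.+1 v a -> flat k.+1 v b -> s + t = 1 ->
    flat k.+1 v (s *: a + t *: b).
  by move=> av bv st i ki; rewrite !mxE av // bv // -mulrDl st mul1r.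
have extI a b : flat k.+1 v a -> flat k.+1 v b -> top_set a = top_set b ->
    exists2 e, 0 < e & I (top_set b) (b 0 q + e * (b 0 q - a 0 q)).
  move=> av bv ab; have [e e0 eT] := top_set_extend ab; exists e => //.
  exists (b + e *: (b - a)) => //; split; last by rewrite !mxE.
  by move=> i ki; rewrite !mxE av // bv // subrr mulr0 addr0.
have -> : cells (flat k.+1 v) = [set T | `[< exists t, I T t >]].
  apply/setP => T; rewrite [RHS]inE; apply/cellsP/asboolP => [[a av aT]|[t [a [av _] aT]]].
    by exists (a 0 q), a.
  by exists a.
apply: odd_sweep => [T s t u [a [av <-] aT] [b [bv <-] bT]|T s t [a [av <-] aT] [b [bv <-] bT] ab|T s t [a [av <-] aT] [b [bv <-] bT] ab|t].
- case/andP=> sat; rewrite le_eqVlt => /orP[/eqP ->|tb]; first by exists b.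
  have ab : 0 < b 0 q - a 0 q by lra.
  have ab0 : b 0 q - a 0 q != 0 by rewrite gt_eqF.
  (* Barycentric weights of the point at height t on the segment from [a] to [b]; [x] is positive
     because t lies strictly before [b]. *)
  pose x := (b 0 q - t) / (b 0 q - a 0 q); pose y := (t - a 0 q) / (b 0 q - a 0 q).
  exists (x *: a + y *: b); last first.
    have xy := top_set_comb _ _ (etrans aT (esym bT)); rewrite xy //; first by apply: divr_gt0; lra.
    by apply: divr_ge0; lra.
  split; last by rewrite !mxE /x /y; field.
  by apply: flat_comb => //; rewrite /x /y; field.
- have [e e0 Ie] := extI b a bv av (etrans bT (esym aT)).
  exists (a 0 q + e * (a 0 q - b 0 q)); last by rewrite -aT.
  have : 0 < e * (b 0 q - a 0 q) by rewrite mulr_gt0 // subr_gt0.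
  lra.
- have [e e0 Ie] := extI a b av bv (etrans aT (esym bT)).
  exists (b 0 q + e * (b 0 q - a 0 q)); last by rewrite -bT.
  have : 0 < e * (b 0 q - a 0 q) by rewrite mulr_gt0 // subr_gt0.
  lra.
(* Base point of the slice at height t: coordinate [q] is now fixed to t. *)
pose w := \row_j (if j == q then t else v 0 j).
have := IHk w (ltnW kd).
suff -> : [set T | `[< I T t >]] = cells (flat k w) by [].
apply/setP => T; rewrite [LHS]inE; apply/asboolP/cellsP => [[a [av aq] aT]|[a aw aT]].
  exists a => // i ki; rewrite mxE; case: eqP => [->//|iq]; apply: av.
  by rewrite ltn_neqAle ki andbT; apply/eqP => E; apply: iq; apply: val_inj.
exists a => //; split=> [i ki|]; last by rewrite aw // mxE eqxx.
rewrite aw 1?ltnW // mxE; case: eqP => // E; move: ki; rewrite E /= ltnn //.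
Qed.

(** * Central symmetry and the number of cells modulo 4 *)

Hypothesis p_symmetric : forall i, exists j, p j = - p i.
Hypothesis p_spanning : forall a, a != 0 -> exists i, dot a (p i) != 0.

(** Defined through positions, since several labels may name the same point. It is an involution on
    top sets, which contain all labels of each of their points. *)
Definition opp_set (T : {set 'I_n}) : {set 'I_n} :=
  [set j | [exists i in T, p j == - p i]].

Lemma top_setN a : top_set (- a) = opp_set (top_set a).
Proof.
apply/setP => j; rewrite [RHS]inE; apply/top_setP/existsP => [jmax|[i /andP[/top_setP ia /eqP ->]] l].
  have [i ij] := p_symmetric j; exists i; rewrite ij opprK eqxx andbT.
  apply/top_setP => l; have [l' ll'] := p_symmetric l.
  by have := jmax l'; rewrite ij ll' !dotN !dotxN !opprK.
have [l' ll'] := p_symmetric l; have := ia l'.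
by rewrite ll' !dotN !dotxN opprK lerNl.
Qed.

Lemma opp_setK a : opp_set (opp_set (top_set a)) = top_set a.
Proof. by rewrite -!top_setN opprK. Qed.

(** A label top for both [a] and [- a] makes [dot a] constant on the points; by symmetry the
    constant is 0, against spanning. *)
Lemma top_setN_neq a : a != 0 -> top_set (- a) != top_set a.
Proof.
move=> /p_spanning[i ai]; apply/eqP => E; have [k ka] := top_set_ex a i.
have kNa := ka; rewrite -E in kNa; have [j ji] := p_symmetric i.
move/top_setP: ka => ka; move/top_setP: kNa => kNa.
have := ka i; have := ka j; have := kNa i; have := kNa j.
move/eqP: ai; rewrite ji !dotN !dotxN; lra.
Qed.

(** If all labels were top for [a], they would be for [- a] as well. So the cell of 0 is reduced to
    0. *)
Lemma top_set_neqT a : a != 0 -> top_set a != top_set 0.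
Proof.
move=> a0; apply: contra (top_setN_neq a0) => /eqP aT.
have inT i : i \in top_set a by rewrite aT; apply/top_setP => j; rewrite !dot0.
rewrite finset.eqEsubset; apply/andP; split; apply/fintype.subsetP => i _ //.
apply/top_setP => j; rewrite !dotN lerN2; have /top_setP := inT j; exact.
Qed.

(* A cell meeting the hyperplane [a 0 q = 0] outside 0 either lies in it, and such
   cells form antipodal pairs, or meets both open sides; the cells of a side are
   those meeting the flat [a 0 q = 1]. *)
Lemma card_cells_step k (kd : (k < d)%N) :
  (#|cells (fun a => flat k.+1 0 a /\ a != 0%R)| +
   #|cells (fun a => flat k 0 a /\ a != 0%R)| = 2 %[mod 4])%N.
Proof.
pose q := Ordinal kd.
set A := cells _; set Z := cells (fun a => flat k 0 a /\ _).
pose Pos := cells (fun a => flat k.+1 0 a /\ 0 < a 0 q).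
pose Neg := cells (fun a => flat k.+1 0 a /\ a 0 q < 0).
have flat_q a : flat k.+1 0 a -> a 0 q = 0 -> flat k 0 a.
  move=> a0 aq i; rewrite leq_eqVlt => /orP[/eqP ki|/a0//].
  by have <- : q = i by [apply: val_inj]; rewrite aq mxE.
have flatS a : flat k 0 a -> flat k.+1 0 a by move=> a0 i /ltnW; apply: a0.
have flatN l a : flat l 0 a -> flat l 0 (- a).
  by move=> a0 i li; rewrite mxE a0 // mxE oppr0.
have neq0 (a : 'rV[R]_d) : a 0 q != 0 -> a != 0 by apply: contraNneq => ->; rewrite mxE.
have oppPos T : T \in Pos -> opp_set T \in Neg.
  case/cellsP => a [a0 aq] <-; rewrite -top_setN; apply/cellsP; exists (- a) => //.
  by split; [exact: flatN|rewrite mxE oppr_lt0].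
have oppNeg T : T \in Neg -> opp_set T \in Pos.
  case/cellsP => a [a0 aq] <-; rewrite -top_setN; apply/cellsP; exists (- a) => //.
  by split; [exact: flatN|rewrite mxE oppr_gt0].
have odd_Pos : odd #|Pos|.
  have := odd_cells_flat (delta_mx 0 q) (ltnW kd).
  suff -> : Pos = cells (flat k (delta_mx 0 q)) by [].
  apply/setP => T; apply/cellsP/cellsP => [[a [a0 aq] aT]|[a aq aT]].
    exists ((a 0 q)^-1 *: a); last by rewrite top_setZ // invr_gt0.
    move=> i; rewrite !mxE eqxx /=; case: (eqVneq i q) => [-> _|iq ki].
      by rewrite mulVf // gt_eqF.
    have ki' : (k < i)%N.
      by rewrite ltn_neqAle ki andbT; apply: contraNneq iq => E; apply/eqP/val_inj.
    by rewrite (a0 i) // mxE mulr0.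
  exists a => //; split; last by rewrite aq // mxE !eqxx.
  move=> i ki; rewrite aq 1?ltnW // !mxE eqxx /=; case: eqP => // E.
  by move: ki; rewrite E ltnn.
have card_Neg : #|Neg| = #|Pos|.
  have -> : Neg = opp_set @: Pos.
    apply/setP => T; apply/idP/imsetP => [TN|[U UP ->]]; last exact: oppPos.
    exists (opp_set T); first exact: oppNeg.
    by case/cellsP: TN => a _ <-; rewrite opp_setK.
  apply: card_in_imset => T U /cellsP[a _ <-] /cellsP[b _ <-] E.
  by rewrite -(opp_setK a) E opp_setK.
(* Moving from [a] slightly past [b], which lies in the hyperplane, reaches the other side within
   the same cell. *)
have ext a b : flat k.+1 0 a -> flat k 0 b -> top_set a = top_set b ->
   exists c, [/\ flat k.+1 0 c, top_set c = top_set b & exists2 e, 0 < e & c 0 q = - (e * a 0 q)].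
  move=> a0 b0 ab; have [e e0 eT] := top_set_extend ab.
  exists (b + e *: (b - a)); split=> //.
    by move=> i ki; rewrite !mxE a0 // flatS // !mxE oppr0 addr0 mulr0 addr0.
  by exists e => //; rewrite !mxE (b0 q) // mxE; ring.
have PosNeg T : T \in Pos -> T \in Neg -> T \in Z.
  case/cellsP=> a [a0 aq] aT /cellsP[b [b0 bq] bT].
  (* Both weights are positive and they cancel coordinate [q]. *)
  pose c := (- b 0 q) *: a + a 0 q *: b.
  have cT : top_set c = T by rewrite (top_set_comb _ _ (etrans aT (esym bT))) //; lra.
  apply/cellsP; exists c => //; split.
    apply: flat_q => [i ki|]; first by rewrite !mxE (a0 i) // (b0 i) // !mxE; ring.
    by rewrite !mxE; ring.
  have /top_set_neqT : a != 0 by apply: neq0; rewrite gt_eqF.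
  by apply: contraNneq => c0; rewrite aT -cT c0.
have ZPos T : T \in Z -> T \in Pos -> T \in Neg.
  case/cellsP=> b [b0 _] bT /cellsP[a [a0 aq] aT].
  have [c [c0 cT [e e0 cq]]] := ext a b a0 b0 (etrans aT (esym bT)).
  apply/cellsP; exists c; last by rewrite cT.
  by split=> //; rewrite cq oppr_lt0 mulr_gt0.
have ZNeg T : T \in Z -> T \in Neg -> T \in Pos.
  case/cellsP=> b [b0 _] bT /cellsP[a [a0 aq] aT].
  have [c [c0 cT [e e0 cq]]] := ext a b a0 b0 (etrans aT (esym bT)).
  apply/cellsP; exists c; last by rewrite cT.
  by split=> //; rewrite cq -mulrN mulr_gt0 // oppr_gt0.
have AE T : (T \in A) = [|| T \in Pos, T \in Neg | T \in Z].
  apply/idP/or3P => [/cellsP[a [a0 an0] aT]|[] /cellsP[a [a0 aq] aT]].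
  - case: (ltrgtP (a 0 q) 0) => aq; [apply: Or32|apply: Or31|apply: Or33];
      apply/cellsP; exists a => //; split=> //; exact: flat_q.
  - by apply/cellsP; exists a => //; split=> //; apply: neq0; rewrite gt_eqF.
  - by apply/cellsP; exists a => //; split=> //; apply: neq0; rewrite lt_eqF.
  - by apply/cellsP; exists a => //; split=> //; exact: flatS.
have even_ZPos : (2 %| #|Z :\: Pos|)%N.
  apply: (@dvd2_card_free _ opp_set) => T; rewrite finset.in_setD => /andP[TP].
  - case/cellsP=> a [a0 an0] aT; rewrite finset.in_setD; apply/andP; split.
      apply: contra TP => /oppPos; rewrite -aT opp_setK aT; apply: ZNeg.
      by apply/cellsP; exists a.
    rewrite -aT -top_setN; apply/cellsP; exists (- a) => //.
    by split; [exact: flatN|rewrite oppr_eq0].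
  - by case/cellsP=> a _ <-; rewrite opp_setK.
  by case/cellsP=> a [_ an0] <-; rewrite -top_setN top_setN_neq.
have cardE (X : {set {set 'I_n}}) : #|X| = (\sum_T (T \in X))%N.
  by rewrite -sum1_card big_mkcond; apply: eq_bigr => T _; case: (T \in X).
(* Checked cell by cell: one in all three of [Pos], [Neg], [Z] counts 2 on each side, one only in
   [Pos] or only in [Neg] counts 1, one only in [Z] counts 2. No other combination occurs. *)
have : (#|A| + #|Z| = #|Pos| + #|Neg| + 2 * #|Z :\: Pos|)%N.
  rewrite !cardE big_distrr -!big_split /=; apply: eq_bigr => T _.
  rewrite AE finset.in_setD; move: (PosNeg T) (ZPos T) (ZNeg T).
  by case: (T \in Pos); case: (T \in Neg); case: (T \in Z) => // H1 H2 H3;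
     first [have := H1 isT isT | have := H2 isT isT | have := H3 isT isT].
rewrite card_Neg; case/dvdnP: even_ZPos => h ->.
by have := odd_double_half #|Pos|; rewrite odd_Pos; lia.
Qed.

(** The step lemma turns [2 * k] into [2 - 2 * k], which is [2 * (k + 1)] modulo 4. *)
Lemma card_cells_neq0 : (#|cells (fun a => a != 0%R)| = 2 * d %[mod 4])%N.
Proof.
have flat_card k : (k <= d)%N ->
    (#|cells (fun a => flat k 0 a /\ a != 0%R)| = 2 * k %[mod 4])%N.
  elim: k => [_|k IHk kd].
    suff -> : cells (fun a => flat 0 0 a /\ a != 0) = finset.set0 by rewrite cards0.
    apply/setP => T; rewrite finset.in_set0; apply/cellsP => -[a [a0 /eqP[]]].
    by apply/rowP => i; rewrite a0.
  by have := IHk (ltnW kd); have := card_cells_step kd; lia.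
rewrite -(flat_card d (leqnn d)).
suff -> : cells (fun a => flat d 0 a /\ a != 0) = cells (fun a => a != 0) by [].
apply/setP => T; apply/cellsP/cellsP => -[a a0 aT]; exists a => //; first by case: a0.
by split=> // i; rewrite leqNgt ltn_ord.
Qed.
End Cells.

(** * Faces of a centrally symmetric polytope *)

Section Faces.
Variables (R : realType) (n : nat) (P : set 'rV[R]_3) (p : 'I_n -> 'rV[R]_3).
Hypothesis Pp : forall i, P (p i).
Hypothesis P_hull : forall x, P x -> exists2 l : 'I_n -> R,
  (forall i, 0 <= l i) /\ \sum_i l i = 1 & x = \sum_i l i *: p i.
Hypothesis P_full : full_dim3 P.
Hypothesis P_symmetric : forall x, P x -> P (- x).

Definition vertex_set (F : set 'rV[R]_3) : {set 'I_n} := [set i | `[< F (p i) >]].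

Definition proper_face F := [/\ is_face P F, exists x, F x & F <> P].

Let dotp_sum a (l : 'I_n -> R) : dotp a (\sum_i l i *: p i) = \sum_i l i * dotp a (p i).
Proof.
transitivity (dot (\sum_i l i *: p i) a); first exact: dotC.
transitivity (\sum_i l i * dot (p i) a); last by apply: eq_bigr => i _; congr (_ * _); apply: dotC.
by elim/big_rec2: _ => [|i y x _ <-]; rewrite ?dot0 // dotD dotZ.
Qed.

(** On the face the weighted slacks [l i * (b - dotp a (p i))] are nonnegative with sum 0, so every
    point of nonzero weight lies on the supporting hyperplane. *)
Lemma face_hull F x : is_face P F -> F x -> exists2 l : 'I_n -> R,
  \sum_i l i = 1 /\ x = \sum_i l i *: p i & forall i, l i != 0 -> F (p i).
Proof.
move=> [a [b [ab ->]]] [/P_hull[l [l0 l1] ->] xb]; exists l => // i li; split=> //.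
have : \sum_i l i * (b - dotp a (p i)) = 0.
  under eq_bigr do rewrite mulrBr; rewrite sumrB -mulr_suml l1 mul1r.
  by rewrite -dotp_sum xb subrr.
have ge0 j : true -> 0 <= l j * (b - dotp a (p j)).
  by move=> _; rewrite mulr_ge0 // subr_ge0 ab.
move/eqP; rewrite psumr_eq0 // => /allP/(_ i (mem_index_enum i)) /=.
by rewrite mulf_eq0 (negPf li) subr_eq0 /= => /eqP.
Qed.

Lemma face_sub F G : is_face P F -> is_face P G ->
  vertex_set F \subset vertex_set G -> (F `<=` G)%classic.
Proof.
move=> Ff [a [b [ab ->]]] /fintype.subsetP FG x Fx.
have Px : P x by case: Ff Fx => a' [b' [_ ->]] [].
split=> //; have [l [l1 ->] lF] := face_hull Ff Fx.
rewrite dotp_sum -[b]mul1r -l1 mulr_suml; apply: eq_bigr => i _.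
have [->|/lF Fi] := eqVneq (l i) 0; first by rewrite !mul0r.
by have := FG i; rewrite !inE => /(_ Fi)[_ ->].
Qed.

Lemma vertex_set_inj F G : is_face P F -> is_face P G ->
  vertex_set F = vertex_set G -> F = G.
Proof. by move=> Ff Gf E; apply/seteqP; split; apply: face_sub; rewrite // E. Qed.

Let P_neq0 a : a != 0 -> exists2 x, P x & dotp a x != 0.
Proof.
move=> a0; apply: contrapT => nx; apply: P_full; exists a, 0; split=> // x Px.
by apply/eqP; apply: contrapT => /negP ax; apply: nx; exists x.
Qed.

Lemma hull_spanning a : a != 0 -> exists i, dot a (p i) != 0.
Proof.
move=> /P_neq0[_ /P_hull[l _ ->]]; rewrite dotp_sum => ax.
apply: contrapT => nx; move/negP: ax; apply; rewrite big1 // => i _.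
have -> : dotp a (p i) = 0; last by rewrite mulr0.
by apply/eqP; apply: contrapT => /negP ai; apply: nx; exists i.
Qed.

Lemma face_vertex F x : is_face P F -> F x -> exists i, F (p i).
Proof.
move=> Ff /(face_hull Ff)[l [l1 _] lF].
apply: contrapT => nF; have : \sum_i l i = 0; last by move/eqP; rewrite l1 oner_eq0.
apply: big1 => i _; apply/eqP; apply: contrapT => /negP/lF Fi.
by apply: nF; exists i.
Qed.

(** With the next lemma, this matches proper nonempty faces with cells outside 0. Here [a = 0] would
    give [F = P]; conversely, full dimension keeps the face in a nonzero direction proper. *)
Lemma vertex_set_cells F : proper_face F -> vertex_set F \in cells p (fun a => a != 0).
Proof.
move=> [Ff [x Fx] FP]; have [i Fi] := face_vertex Ff Fx.
case: Ff Fi FP => a [b [ab ->]] [Pi ai] FP; apply/cellsP; exists a.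
  apply/eqP => a0; apply: FP; apply/seteqP; split=> [y []//|y Py]; split=> //.
  by rewrite -ai a0; apply: etrans (dot0 _) (esym (dot0 _)).
apply/setP => j; rewrite [RHS]inE; apply/top_setP/asboolP => [jmax|[Pj aj] l].
  split=> //; apply/eqP; rewrite eq_le ab //= -ai; exact: jmax.
by have := ab _ (Pp l); rewrite -aj.
Qed.

Lemma cells_vertex_set T : T \in cells p (fun a => a != 0) ->
  exists2 F, proper_face F & vertex_set F = T.
Proof.
case/cellsP => a a0 <-; have [i0 _] := hull_spanning a0.
have [i itop] := top_set_ex p a i0; have /top_setP imax := itop.
exists [set x | P x /\ dotp a x = dotp a (p i)]%classic; last first.
  apply/setP => j; rewrite [LHS]inE; apply/asboolP/top_setP => [[_ aj] l|jmax].
    by apply: le_trans (imax l) _; rewrite -[dot a (p i)]aj.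
  by split=> //; apply/eqP; rewrite eq_le; apply/andP; split; [exact: imax|exact: jmax].
split.
- exists a, (dotp a (p i)); split=> // x /P_hull[l [l0 l1] ->].
  rewrite dotp_sum -[leRHS]mul1r -l1 mulr_suml; apply: ler_sum => j _.
  by apply: ler_wpM2l => //; exact: imax.
- by exists (p i).
- move=> FP; apply: P_full; exists a, (dotp a (p i)); split=> // x.
  by rewrite -{1}FP => -[].
Qed.

(** If [-F = F] then [b = - b], so [b = 0]; by symmetry of [P] the functional vanishes on [P], and
    [F = P]. *)
Lemma proper_face_opp_neq F : proper_face F -> central_map F <> F.
Proof.
move=> [[a [b [ab FE]]] [x Fx] FP] opF.
have [Px ax] : P x /\ dotp a x = b by move: Fx; rewrite FE.
have dN y : dotp a (- y) = - dotp a y by exact: dotxN.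
have [_ aNx] : P (- x) /\ dotp a (- x) = b.
  have : F (- x) by rewrite -opF; exists x.
  by rewrite FE.
apply: FP; rewrite FE; apply/seteqP; split=> [y []//|y Py]; split=> //.
by have := ab _ Py; have := ab _ (P_symmetric Py); move: aNx; rewrite !dN ax; lra.
Qed.

Lemma dvd4_card_proper_faces (h : set 'rV[R]_3 -> set 'rV[R]_3) :
    (forall F, is_face P F -> is_face P (h F)) ->
    (forall F G, is_face P F -> is_face P G -> (F `<=` G <-> h F `<=` h G)%classic) ->
    (forall F, is_face P F -> h (h F) = central_map F) ->
  (4 %| #|cells p (fun a => a != 0%R)|)%N.
Proof.
move=> hface hsub hh.
have face0 : is_face P set0.
  exists 0, 1; split=> [x _|]; first by rewrite [leLHS]dot0.
  apply/seteqP; split=> // x [_]; rewrite [dotp _ _]dot0 => /eqP.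
  by rewrite eq_sym oner_eq0.
have faceP : is_face P P.
  exists 0, 0; split=> [x _|]; first by rewrite [leLHS]dot0.
  by apply/seteqP; split=> [x Px|x []//]; split=> //; exact: dot0.
have face_subP F : is_face P F -> (F `<=` P)%classic by move=> [a [b [_ ->]]] x [].
(* Since [h] also reflects inclusion, comparison with [h set0] and [h P] shows that only the empty
   face can have empty image and only [P] image [P]. *)
have hproper F : proper_face F -> proper_face (h F).
  move=> [Ff [x Fx] FP]; split; first exact: hface.
    apply: contrapT => hF0; have /(hsub _ _ Ff face0)/(_ x Fx) : (h F `<=` h set0)%classic.
      by move=> y hFy; case: hF0; exists y.
    by [].
  move=> hFP; apply: FP; apply/seteqP; split; first exact: face_subP.
  by apply/(hsub _ _ faceP Ff); rewrite hFP; apply: face_subP; exact: hface.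
(* Inverse of [vertex_set] on proper faces, as a union over at most one face; it carries [h] over to
   the finite type of label sets. *)
pose face T : set 'rV[R]_3 := [set x | exists F, [/\ proper_face F, vertex_set F = T & F x]]%classic.
have faceK F : proper_face F -> face (vertex_set F) = F.
  move=> pF; apply/seteqP; split=> [x [G [pG GF Gx]]|x Fx]; last by exists F.
  by case: pF => Ff _ _; case: pG => Gf _ _; rewrite -(vertex_set_inj Gf Ff GF).
apply: (@dvd4_card_free _ (fun T => vertex_set (h (face T)))) => T.
- case/cells_vertex_set=> F pF <-; rewrite faceK //.
  exact/vertex_set_cells/hproper.
- case/cells_vertex_set=> F pF <-; have pF1 := hproper F pF.
  have pF2 := hproper _ pF1; have pF3 := hproper _ pF2.
  rewrite !faceK //; have [Ff _ _] := pF; rewrite hh; last exact/hface/hface.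
  rewrite hh //; congr vertex_set; apply/seteqP; split=> [_ [_ [x Fx <-] <-]|x Fx].
    by rewrite opprK.
  by exists (- x); [exists x|rewrite opprK].
case/cells_vertex_set=> F pF <-; have [Ff _ _] := pF; have pF1 := hproper F pF.
rewrite !faceK //.
apply/eqP => /vertex_set_inj; rewrite hh // => E.
have cf : is_face P (central_map F) by rewrite -hh //; exact/hface/hface.
exact: (proper_face_opp_neq pF (E cf Ff)).
Qed.
End Faces.

(** * Symmetric generating points and the final contradiction *)

Lemma symmetric_hull (R : realType) (P : set 'rV[R]_3) (S : seq 'rV[R]_3) :
    P = conv S -> centrally_symmetric P ->
  exists n (p : 'I_n -> 'rV[R]_3), [/\ forall i, P (p i),
    forall x, P x -> exists2 l : 'I_n -> R,
      (forall i, 0 <= l i) /\ \sum_i l i = 1 & x = \sum_i l i *: p i &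
    forall i, exists j, p j = - p i].
Proof.
move=> PS Psym.
(* The points of [S] followed by their negatives; the latter lie in [P] by symmetry and receive
   weight 0 in convex combinations. *)
pose p i := match split i with inl j => S`_(nat_of_ord (j : 'I_(size S)))
                             | inr j => - S`_(nat_of_ord (j : 'I_(size S))) end.
have pl j : p (lshift _ j) = S`_j by rewrite /p (unsplitK (inl _ j)).
have pr j : p (rshift _ j) = - S`_j by rewrite /p (unsplitK (inr _ j)).
have PS_nth (j : 'I_(size S)) : P S`_j.
  rewrite PS; exists (fun i => (i == j)%:R); split=> [i|]; first exact: ler0n.
  split; rewrite (bigD1 j) //= eqxx big1 ?addr0 ?scale1r //.
    by move=> i /negPf->.
  by move=> i /negPf->; rewrite scale0r.
exists (size S + size S)%N, p; split=> [i|x|i].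
- rewrite -(splitK i); case: (split i) => j /=; first by rewrite pl.
  by rewrite pr -Psym; exists S`_j.
- rewrite PS => -[l [l0 [l1 ->]]].
  pose l' (i : 'I_(size S + size S)) := match split i with inl j => l j | inr _ => 0 end.
  have ll j : l' (lshift _ j) = l j by rewrite /l' (unsplitK (inl _ j)).
  have lr j : l' (rshift _ j) = 0 by rewrite /l' (unsplitK (inr _ j)).
  exists l'; rewrite !big_split_ord /=.
    split; first by move=> i; rewrite /l'; case: (split i).
    by rewrite [X in _ + X]big1 ?addr0 // -l1; apply: eq_bigr => i _; rewrite ll.
  rewrite [X in _ + X]big1 ?addr0; last by move=> i _; rewrite lr scale0r.
  by apply: eq_bigr => i _; rewrite ll pl.
rewrite -(splitK i); case: (split i) => j /=.
  by exists (rshift _ j); rewrite pr pl.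
by exists (lshift _ j); rewrite pr pl opprK.
Qed.

Theorem theorem5 (R : realType) (m : nat) (hm : (1 <= m)%N) :
  ~ exists (P : set 'rV[R]_3) (g : set 'rV[R]_3 -> set 'rV[R]_3),
      is_3polytope P /\ centrally_symmetric P /\
      aut_cyclic_gen P (4 * m) g /\
      eq_on_faces P (iter (2 * m) g) (@central_map R).
Proof.
move=> [P [g [[S [PS Pfull]] [Psym [[[gface [_ gsub]] _] g2m]]]]].
have [n [p [Pp Phull psym]]] := symmetric_hull PS Psym.
have PN x : P x -> P (- x) by move=> Px; rewrite -Psym; exists x.
have hface k F : is_face P F -> is_face P (iter k g F).
  by move=> Ff; elim: k => //= k; exact: gface.
have hsub k F G : is_face P F -> is_face P G ->
    (F `<=` G <-> iter k g F `<=` iter k g G)%classic.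
  move=> Ff Gf; elim: k => //= k IH; apply: iff_trans IH _.
  by apply: gsub; exact: hface.
have gg F : is_face P F -> iter m g (iter m g F) = central_map F.
  by move=> Ff; rewrite -iterD addnn -mul2n g2m.
have := dvd4_card_proper_faces Pp Phull Pfull PN (hface m) (hsub m) gg.
(* In dimension 3 the number of cells is 6, that is 2, modulo 4. *)
by rewrite /dvdn (card_cells_neq0 psym (hull_spanning Phull Pfull)).
Qed.
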